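(* Let $X$ be a rack and let $A$ be an $X$-module with structure maps $(\eta_{ij}),(\tau_{ij})$. For $i,j\in X$ define $\alpha_{ij}:A\times A\to A$ by $\alpha_{ij}(s,t)=\eta_{ij}(t)+\tau_{ij}(s)$. (1) $\alpha$ is a (rack) dynamical cocycle; hence one can form the rack $Y=X\times_\alpha A$. (2) The canonical projection $p:Y=X\times_\alpha A\to X$ is an abelian group object in the category $\mathfrak{R}|_X$ of racks over $X$. (3) If $p:Y\to X$ is an abelian group object in $\mathfrak{R}|_X$ and $X$ is indecomposable, then $Y\simeq X\times_\alpha A$ for some $X$-module $A$ (with $\alpha$ defined from $A$ by the formula $\alpha_{ij}(s,t)=\eta_{ij}(t)+\tau_{ij}(s)$), and under this isomorphism $p$ is the canonical projection. (4) If $X$ is a quandle and ''$X$-module'' is replaced by ''quandle $X$-module'', then statements (1)-(3) are true in the category of quandles (with quandle dynamical cocycles and the category of quandles over $X$). Likewise, if $X$ is a crossed set, statements (1)-(3) are true in the category of crossed sets, with crossed set structures of $X$-module, crossed set dynamical cocycles and the category of crossed sets over $X$.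
   Context: A rack is a pair $(X,\triangleright)$ where $X$ is a non-empty set and $\triangleright:X\times X\to X$ is such that each $\phi_i(j)=i\triangleright j$ is a bijection of $X$ and $i\triangleright(j\triangleright k)=(i\triangleright j)\triangleright(i\triangleright k)$ for all $i,j,k$. A quandle is a rack with $i\triangleright i=i$ for all $i$. A crossed set is a quandle such that $j\triangleright i=i$ whenever $i\triangleright j=j$. Morphisms are the maps preserving $\triangleright$. A subrack is a non-empty subset $Z$ with $Z\triangleright Z=Z$; a rack is decomposable if it is a disjoint union of two subracks, and indecomposable otherwise. The category $\mathfrak R|_X$ has as objects the rack morphisms $f:Y\to X$ and as arrows from $f:Y\to X$ to $g:Z\to X$ the rack morphisms $h:Y\to Z$ with $gh=f$; it has finite limits (products are fibre products over $X$, the terminal object is $\mathrm{id}_X$), so abelian group objects make sense in it. The same applies to quandles, resp. crossed sets, over $X$. $X$-module: let $A$ be an abelian group. A structure of $X$-module on $A$ consists of automorphisms $\eta_{ij}\in\mathrm{Aut}(A)$ and endomorphisms $\tau_{ij}\in\mathrm{End}(A)$, $i,j\in X$, such that for all $i,j,k\in X$: $\eta_{i,j\triangleright k}\eta_{j,k}=\eta_{i\triangleright j,i\triangleright k}\eta_{i,k}$; $\tau_{i,j\triangleright k}=\eta_{i\triangleright j,i\triangleright k}\tau_{i,k}+\tau_{i\triangleright j,i\triangleright k}\tau_{i,j}$; $\eta_{i,j\triangleright k}\tau_{j,k}=\tau_{i\triangleright j,i\triangleright k}\eta_{i,j}$. If $X$ is a quandle, the structure is a quandle structure of $X$-module if moreover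 $\eta_{ii}+\tau_{ii}=\mathrm{id}$ for all $i$. If $X$ is a crossed set, it is a crossed set structure of $X$-module if it is a quandle structure and moreover: if $i\triangleright j=j$ and $(\mathrm{id}-\eta_{ij})(t)=\tau_{ij}(s)$ for some $s,t\in A$, then $(\mathrm{id}-\eta_{ji})(s)=\tau_{ji}(t)$. Dynamical cocycle: for a non-empty set $S$, a function $\alpha:X\times X\to\mathrm{Fun}(S\times S,S)$ is a rack dynamical cocycle if every map $t\mapsto\alpha_{ij}(s,t)$ is a bijection of $S$ and $\alpha_{i,j\triangleright k}(s,\alpha_{jk}(t,u))=\alpha_{i\triangleright j,i\triangleright k}(\alpha_{ij}(s,t),\alpha_{ik}(s,u))$ for all $i,j,k\in X$, $s,t,u\in S$; it is a quandle dynamical cocycle if moreover $\alpha_{ii}(s,s)=s$; it is a crossed set dynamical cocycle if moreover $\alpha_{ji}(t,s)=s$ whenever $i\triangleright j=j$ and $\alpha_{ij}(s,t)=t$. Then $X\times_\alpha S$ denotes $X\times S$ with $(i,s)\triangleright(j,t)=(i\triangleright j,\alpha_{ij}(s,t))$, which is a rack (resp. quandle, crossed set), with canonical projection $(i,s)\mapsto i$. *)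

(* Defs.v *)
From HB Require Import structures.
From mathcomp Require Import all_boot all_order all_algebra.
From mathcomp Require Import boolp classical_sets.

Set Implicit Arguments.
Unset Strict Implicit.
Unset Printing Implicit Defensive.

Import GRing.Theory.

Local Open Scope classical_set_scope.
Local Open Scope ring_scope.

Reserved Notation "i |> j" (at level 40, left associativity).
Reserved Notation "g \oC f" (at level 50, left associativity).

Record rack := Rack_ {
  rack_sort :> Type;
  rack_op : rack_sort -> rack_sort -> rack_sort;
  rack_nonempty : inhabited rack_sort;
  rack_bij : forall i, bijective (rack_op i);
  rack_dist : forall i j k,
    rack_op i (rack_op j k) = rack_op (rack_op i j) (rack_op i k) }.

Notation "i |> j" := (rack_op i j) : ring_scope.

Definition is_quandle (X : rack) : Prop := forall i : X, i |> i = i.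

Definition is_crossed_set (X : rack) : Prop :=
  is_quandle X /\ forall i j : X, i |> j = j -> j |> i = i.

Definition rack_morphism (X Y : rack) (f : X -> Y) : Prop :=
  forall i j, f (i |> j) = f i |> f j.

Definition subrack (X : rack) (Z : set X) : Prop :=
  Z !=set0 /\ [set i |> j | i in Z & j in Z] = Z.

Definition decomposable (X : rack) : Prop :=
  exists Y Z : set X,
    [/\ subrack Y, subrack Z, Y `&` Z = set0 & Y `|` Z = [set: X]].

Definition indecomposable (X : rack) : Prop := ~ decomposable X.

(** The three settings (racks, quandles, crossed sets) in which the theory is
    developed are handled uniformly, by a parameter [k : rack_kind]. *)
Inductive rack_kind := Racks | Quandles | CrossedSets.

Definition has_kind (k : rack_kind) (X : rack) : Prop :=
  match k with
  | Racks => True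
  | Quandles => is_quandle X
  | CrossedSets => is_crossed_set X
  end.

Record xmodule (X : rack) (A : zmodType) := XModule {
  mod_eta : X -> X -> {additive A -> A};
  mod_tau : X -> X -> {additive A -> A};
  eta_bij : forall i j, bijective (mod_eta i j);
  eta_eta : forall i j k a,
    mod_eta i (j |> k) (mod_eta j k a) =
    mod_eta (i |> j) (i |> k) (mod_eta i k a);
  tau_eta_tau : forall i j k a,
    mod_tau i (j |> k) a =
    mod_eta (i |> j) (i |> k) (mod_tau i k a) +
    mod_tau (i |> j) (i |> k) (mod_tau i j a);
  eta_tau : forall i j k a,
    mod_eta i (j |> k) (mod_tau j k a) =
    mod_tau (i |> j) (i |> k) (mod_eta i j a) }.

Definition quandle_structure (X : rack) (A : zmodType) (M : xmodule X A) :
    Prop :=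
  forall i a, mod_eta M i i a + mod_tau M i i a = a.

Definition crossed_set_structure (X : rack) (A : zmodType) (M : xmodule X A) :
    Prop :=
  quandle_structure M /\
  forall i j, i |> j = j -> forall s t : A,
    t - mod_eta M i j t = mod_tau M i j s ->
    s - mod_eta M j i s = mod_tau M j i t.

Definition xmodule_has_kind (k : rack_kind) (X : rack) (A : zmodType)
    (M : xmodule X A) : Prop :=
  match k with
  | Racks => True
  | Quandles => quandle_structure M
  | CrossedSets => crossed_set_structure M
  end.

Section DynamicalCocycle.
Variables (X : rack) (S : Type).
Implicit Type alpha : X -> X -> S -> S -> S.

Definition rack_cocycle alpha : Prop :=
  (forall i j s, bijective (alpha i j s)) /\
  (forall i j k s t u,
     alpha i (j |> k) s (alpha j k t u) =
     alpha (i |> j) (i |> k) (alpha i j s t) (alpha i k s u)).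

Definition quandle_cocycle alpha : Prop :=
  rack_cocycle alpha /\ forall i s, alpha i i s s = s.

Definition crossed_set_cocycle alpha : Prop :=
  quandle_cocycle alpha /\
  forall i j s t, i |> j = j -> alpha i j s t = t -> alpha j i t s = s.

Definition dynamical_cocycle (k : rack_kind) alpha : Prop :=
  match k with
  | Racks => rack_cocycle alpha
  | Quandles => quandle_cocycle alpha
  | CrossedSets => crossed_set_cocycle alpha
  end.

Lemma dynamical_cocycle_rack k alpha :
  dynamical_cocycle k alpha -> rack_cocycle alpha.
Proof. by case: k => [//|[]//|[[]//]]. Qed.

Definition ext_op alpha (x y : X * S) : X * S :=
  (x.1 |> y.1, alpha x.1 y.1 x.2 y.2).

Lemma ext_nonempty : inhabited S -> inhabited (X * S).
Proof. by case: (rack_nonempty X) => x [s]; exists; exact: (x, s). Qed.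

Lemma ext_bij alpha : rack_cocycle alpha ->
  forall x, bijective (ext_op alpha x).
Proof.
move=> [ab _] [i s]; have [f fK Kf] := rack_bij i.
have gP j : exists g, cancel (alpha i j s) g /\ cancel g (alpha i j s).
  by have [g gK Kg] := ab i j s; exists g.
have [g gE] := choice gP.
exists (fun y => (f y.1, g (f y.1) y.2)) => -[j t]; rewrite /ext_op /=.
  by rewrite fK (gE j).1.
by rewrite (gE (f j)).2 Kf.
Qed.

Lemma ext_dist alpha : rack_cocycle alpha -> forall x y z,
  ext_op alpha x (ext_op alpha y z) =
  ext_op alpha (ext_op alpha x y) (ext_op alpha x z).
Proof.
move=> [_ ac] [i s] [j t] [k u]; rewrite /ext_op /=.
by rewrite rack_dist ac.
Qed.

Definition ext_rack (S0 : inhabited S) alpha (ha : rack_cocycle alpha) : rack :=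
  @Rack_ (X * S) (ext_op alpha) (ext_nonempty S0) (ext_bij ha) (ext_dist ha).

Lemma ext_rack_kind k (S0 : inhabited S) alpha (hX : has_kind k X)
    (ha : dynamical_cocycle k alpha) :
  has_kind k (ext_rack S0 (dynamical_cocycle_rack ha)).
Proof.
move: (dynamical_cocycle_rack ha); case: k hX ha => //=.
  by move=> hX [_ hq] ha [i s]; rewrite /= /ext_op /= hX hq.
move=> [hX hX'] [[_ hq] hc] ha; split=> [[i s]|[i s] [j t]].
  by rewrite /= /ext_op /= hX hq.
by rewrite /= /ext_op /= => -[ij st]; rewrite hX' // (hc _ _ _ _ ij).
Qed.

Lemma ext_proj_morphism (S0 : inhabited S) alpha (ha : rack_cocycle alpha) :
  @rack_morphism (ext_rack S0 ha) X fst.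
Proof. by []. Qed.

End DynamicalCocycle.

Definition module_cocycle (X : rack) (A : zmodType) (M : xmodule X A) :
    X -> X -> A -> A -> A :=
  fun i j s t => mod_eta M i j t + mod_tau M i j s.

Record category := Category {
  obj :> Type;
  arrow : obj -> obj -> Type;
  idC : forall a, arrow a a;
  compC : forall a b c, arrow b c -> arrow a b -> arrow a c;
  compC1l : forall a b (f : arrow a b), compC (idC b) f = f;
  compC1r : forall a b (f : arrow a b), compC f (idC a) = f;
  compCA : forall a b c d (h : arrow c d) (g : arrow b c) (f : arrow a b),
    compC h (compC g f) = compC (compC h g) f }.

Arguments idC {C} a : rename.
Notation "g \oC f" := (compC g f).

Definition isomorphic (C : category) (a b : C) : Prop :=
  exists (f : arrow a b) (g : arrow b a), g \oC f = idC a /\ f \oC g = idC b.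

Record terminal (C : category) := Terminal {
  terminal_obj :> C;
  bang : forall a, arrow a terminal_obj;
  bang_uniq : forall a (f : arrow a terminal_obj), f = bang a }.

Record product (C : category) (a b : C) := Product {
  product_obj :> C;
  pr1 : arrow product_obj a;
  pr2 : arrow product_obj b;
  pairing : forall c, arrow c a -> arrow c b -> arrow c product_obj;
  pr1_pairing : forall c (f : arrow c a) (g : arrow c b), pr1 \oC pairing f g = f;
  pr2_pairing : forall c (f : arrow c a) (g : arrow c b), pr2 \oC pairing f g = g;
  pairing_uniq : forall c (h : arrow c product_obj),
    h = pairing (pr1 \oC h) (pr2 \oC h) }.

Arguments pr1 {C a b} p.
Arguments pr2 {C a b} p.
Arguments pairing {C a b} p {c} : rename.

(** Since racks are non-empty, the product of two objects of the category of
    racks over X need not exist: the fibre product may be empty.  Hence only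
    the finite powers of G that enter the axioms are required. *)
Record abelian_group_object (C : category) (G : C) := AbelianGroupObject {
  ag_one : terminal C;
  ag_sq : product G G;
  ag_cube : product ag_sq G;
  ag_add : arrow ag_sq G;
  ag_zero : arrow ag_one G;
  ag_opp : arrow G G;
  ag_addA :
    ag_add \oC pairing ag_sq (ag_add \oC pr1 ag_cube) (pr2 ag_cube) =
    ag_add \oC pairing ag_sq (pr1 ag_sq \oC pr1 ag_cube)
      (ag_add \oC pairing ag_sq (pr2 ag_sq \oC pr1 ag_cube) (pr2 ag_cube));
  ag_addC : ag_add \oC pairing ag_sq (pr2 ag_sq) (pr1 ag_sq) = ag_add;
  ag_add0 :
    ag_add \oC pairing ag_sq (ag_zero \oC bang ag_one G) (idC G) = idC G;
  ag_addN :
    ag_add \oC pairing ag_sq ag_opp (idC G) = ag_zero \oC bang ag_one G }.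

Definition is_abelian_group_object (C : category) (G : C) : Prop :=
  inhabited (abelian_group_object G).

Section Slice.
Variables (C : category) (x : C).

Definition slice_obj : Type := {a : C & arrow a x}.
Implicit Types f g h : slice_obj.

Definition slice_hom f g : Type :=
  {u : arrow (tag f) (tag g) | tagged g \oC u = tagged f}.

Lemma slice_id_over f : tagged f \oC idC (tag f) = tagged f.
Proof. exact: compC1r. Qed.

Lemma slice_comp_over f g h (v : slice_hom g h) (u : slice_hom f g) :
  tagged h \oC (sval v \oC sval u) = tagged f.
Proof. by rewrite compCA (svalP v) (svalP u). Qed.

Definition slice_id f : slice_hom f f := exist _ _ (slice_id_over f).

Definition slice_comp f g h (v : slice_hom g h) (u : slice_hom f g) :
  slice_hom f h := exist _ _ (slice_comp_over v u).

Definition slice : category.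
Proof.
apply: (@Category slice_obj slice_hom slice_id slice_comp).
- by move=> f g [u hu]; apply: eq_exist; rewrite /= compC1l.
- by move=> f g [u hu]; apply: eq_exist; rewrite /= compC1r.
- by move=> f g h l w v u; apply: eq_exist; rewrite /= compCA.
Defined.

End Slice.

Section RackCategory.
Variable k : rack_kind.

Definition kind_obj : Type := {X : rack | has_kind k X}.

Definition kind_hom (X Y : kind_obj) : Type :=
  {f : sval X -> sval Y | rack_morphism f}.

Lemma id_morphism (X : rack) : @rack_morphism X X id.
Proof. by []. Qed.

Lemma comp_morphism (X Y Z : kind_obj) (g : kind_hom Y Z) (f : kind_hom X Y) :
  rack_morphism (sval g \o sval f).
Proof. by move=> i j /=; rewrite (svalP f) (svalP g). Qed.

Definition kind_id (X : kind_obj) : kind_hom X X :=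
  exist _ id (@id_morphism (sval X)).

Definition kind_comp (X Y Z : kind_obj) (g : kind_hom Y Z) (f : kind_hom X Y) :
  kind_hom X Z := exist _ (sval g \o sval f) (comp_morphism g f).

Definition rack_category : category.
Proof.
apply: (@Category kind_obj kind_hom kind_id kind_comp).
- by move=> X Y [f hf]; apply: eq_exist.
- by move=> X Y [f hf]; apply: eq_exist.
- by move=> X Y Z T h g f; apply: eq_exist.
Defined.

End RackCategory.

Definition racks_over (k : rack_kind) (X : rack) (hX : has_kind k X) : category :=
  @slice (rack_category k) (exist _ X hX).

Definition ext_proj (k : rack_kind) (X : rack) (hX : has_kind k X)
    (A : zmodType) (alpha : X -> X -> A -> A -> A)
    (ha : dynamical_cocycle k alpha) : racks_over hX :=
  let A0 := inhabits (0 : A) in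
  existT (fun Y : rack_category k => arrow Y (exist _ X hX : rack_category k))
    (exist _ (ext_rack A0 (dynamical_cocycle_rack ha))
             (ext_rack_kind A0 hX ha))
    (exist _ fst (@ext_proj_morphism X A A0 alpha (dynamical_cocycle_rack ha))).

(* Main.v *)
Require Import Defs.
From HB Require Import structures.
From mathcomp Require Import all_boot all_order all_algebra.
From mathcomp Require Import boolp classical_sets.

Set Implicit Arguments.
Unset Strict Implicit.
Unset Printing Implicit Defensive.

Import GRing.Theory.

Local Open Scope classical_set_scope.
Local Open Scope ring_scope.

(** The bridge between the categorical and the algebraic sides is the notion of
    a fibrewise group on a rack morphism p : Y -> X, namely operations that make
    each fibre of p an abelian group and that are compatible with |> as a whole.
    An abelian group object over X is the same thing
    ([fibrewise_group_object], [group_object_fibrewise]): a terminal object is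
    the identity of X, and a product of two objects is their fibre product
    whenever that is non-empty, which the zero section guarantees here.
    Conversely, an abstract square of p need not be the fibre product on the
    nose, so its group law is transported by evaluating the group axioms on
    generalized elements, that is on arrows out of explicit fibre products.

    Compatibility of addition with |> says that |> : Y_i x Y_j -> Y_(i |> j) is
    a group morphism on the product of the fibres, hence a sum of one morphism
    in each variable:

      a |> b = (0_i |> b) + (a |> 0_j) = eta_ij b + tau_ij a.

    Thus a module cocycle makes X x A a fibrewise group, with the group law of A
    on the second component.  In the other direction, self-distributivity of |>
    on triples with two zero entries gives the three module axioms for eta and
    tau, and the quandle and crossed set conditions on Y give those on the
    module.  It remains to identify all the fibres with a single group A.  Left
    translation by 0_i is an isomorphism Y_j -> Y_(i |> j), so the set of points
    whose fibre is isomorphic to a given one is invariant under all left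
    translations of X and their inverses.  Such a set and its complement are
    subracks when they are non-empty; if X is indecomposable, the set is
    therefore all of X ([indecomposable_invariant], [trivialization_exists]).

    The three kinds of racks are treated together, because fibre products of
    quandles (crossed sets) are again quandles (crossed sets); they differ only
    in the passage between properties of Y, of the cocycle and of the module
    ([module_dynamical_cocycle], [trivialized_kind]). *)

(** * Generalized elements of an abelian group object *)

Section GeneralizedElements.
Variables (C : category) (G : C) (ag : abelian_group_object G).

Lemma pairing_comp (a b c d : C) (P : product a b)
    (f : arrow c a) (g : arrow c b) (h : arrow d c) :
  pairing P f g \oC h = pairing P (f \oC h) (g \oC h).
Proof.
by rewrite [LHS](pairing_uniq (p := P)) !compCA pr1_pairing pr2_pairing.
Qed.

(** The group law induced on the arrows c -> G.  Every axiom of a group object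
    becomes an identity between arrows with an arbitrary source, which no
    longer mentions the chosen powers of G. *)
Definition ptadd (c : C) (f g : arrow c G) : arrow c G :=
  ag_add ag \oC pairing (ag_sq ag) f g.

Definition ptzero (c : C) : arrow c G := ag_zero ag \oC bang (ag_one ag) c.

Lemma ptadd_comp (c d : C) (f g : arrow c G) (h : arrow d c) :
  ptadd f g \oC h = ptadd (f \oC h) (g \oC h).
Proof. by rewrite /ptadd -compCA pairing_comp. Qed.

Lemma ptzero_comp (c d : C) (h : arrow d c) : ptzero c \oC h = ptzero d.
Proof.
by rewrite /ptzero -compCA [_ \oC h](bang_uniq (t := ag_one ag)).
Qed.

Lemma ptaddA (c : C) (f g h : arrow c G) :
  ptadd (ptadd f g) h = ptadd f (ptadd g h).
Proof.
pose t := pairing (ag_cube ag) (pairing (ag_sq ag) f g) h.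
have := congr1 (fun u => u \oC t) (ag_addA ag).
rewrite -!compCA !pairing_comp -!compCA !pairing_comp -!compCA.
by rewrite !pr1_pairing !pr2_pairing.
Qed.

Lemma ptaddC (c : C) (f g : arrow c G) : ptadd f g = ptadd g f.
Proof.
have := congr1 (fun u => u \oC pairing (ag_sq ag) g f) (ag_addC ag).
by rewrite -compCA pairing_comp pr1_pairing pr2_pairing.
Qed.

Lemma ptadd0 (c : C) (f : arrow c G) : ptadd (ptzero c) f = f.
Proof.
have := congr1 (fun u => u \oC f) (ag_add0 ag).
by rewrite -/(ptzero G) -/(ptadd _ _) ptadd_comp ptzero_comp compC1l.
Qed.

Lemma ptaddN (c : C) (f : arrow c G) :
  ptadd (ag_opp ag \oC f) f = ptzero c.
Proof.
have := congr1 (fun u => u \oC f) (ag_addN ag).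
by rewrite -/(ptzero G) -/(ptadd _ _) ptadd_comp ptzero_comp compC1l.
Qed.

End GeneralizedElements.

(** * Racks over a fixed rack *)

Section Over.
Variables (k : rack_kind) (X : rack) (hX : has_kind k X).
Local Notation C := (racks_over hX).

(* The objects and arrows of the slice category are nested dependent pairs;
   these names give access to the underlying racks and functions. *)
Definition total (p : C) : rack := sval (tag p : kind_obj k).
Definition proj (p : C) : total p -> X := sval (tagged p).

Lemma total_kind (p : C) : has_kind k (total p).
Proof. exact: (svalP (tag p : kind_obj k)). Qed.

Lemma projM (p : C) : rack_morphism (@proj p).
Proof. exact: (svalP (tagged p)). Qed.

Definition fct (p q : C) (u : arrow p q) : total p -> total q := sval (sval u).

Lemma fctM (p q : C) (u : arrow p q) : rack_morphism (fct u).
Proof. exact: (svalP (sval u)). Qed.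

Lemma proj_fct (p q : C) (u : arrow p q) y : proj (fct u y) = proj y.
Proof. exact: (congr1 (fun f => sval f y) (svalP u)). Qed.

Lemma arrow_ext (p q : C) (u v : arrow p q) : fct u =1 fct v -> u = v.
Proof.
case: u v => [[u uM] u_over] [[v vM] v_over] /= uv; apply: eq_exist => /=.
by apply: eq_exist; apply/funext.
Qed.

Definition over (Y : rack) (hY : has_kind k Y) (f : Y -> X)
    (fM : rack_morphism f) : C :=
  existT (fun Y : rack_category k =>
            arrow Y (exist _ X hX : rack_category k))
    (exist _ Y hY) (exist _ f fM).

Section MakeArrow.
Variables (p q : C) (f : total p -> total q).
Hypotheses (fM : rack_morphism f) (fp : forall y, proj (f y) = proj y).

Lemma arrow_over :
  (tagged q : arrow (tag q) _) \oC
    (exist _ f fM : arrow (tag p : rack_category k) (tag q)) = tagged p.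
Proof.
move: (fp); rewrite /proj; case: (tagged p) => pp ppM /= fpE.
by apply: eq_exist; apply/funext => y; exact: fpE.
Qed.

Definition mk_arrow : arrow p q := exist _ (exist _ f fM) arrow_over.

End MakeArrow.

Lemma bijective_isomorphic (p q : C) (f : total p -> total q)
    (g : total q -> total p) :
    rack_morphism f -> (forall y, proj (f y) = proj y) ->
  cancel f g -> cancel g f -> isomorphic p q.
Proof.
move=> fM fp fK gK.
have gM : rack_morphism g.
  by move=> y z; apply: (can_inj fK); rewrite fM !gK.
have gp y : proj (g y) = proj y by rewrite -[in RHS](gK y) fp.
exists (mk_arrow fM fp), (mk_arrow gM gp).
by split; apply: arrow_ext => y; [exact: fK|exact: gK].
Qed.

Definition over_terminal : terminal C.
Proof.
pose one : C := over hX (@id_morphism X).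
apply: (@Terminal C one (fun p => @mk_arrow p one _ (@projM p) (fun=> erefl))).
by move=> p f; apply: arrow_ext => y; exact: (proj_fct f y).
Defined.

(** Racks are non-empty, so the fibre product is a rack only when the two
    projections share a value; this is the witness [w]. *)
Section FibreProduct.
Variables (p q : C) (w : exists y z, @proj p y = @proj q z).

Definition fp_carrier : Type :=
  {yz : total p * total q | proj yz.1 = proj yz.2}.

Lemma fp_op_subproof (a b : fp_carrier) :
  proj ((sval a).1 |> (sval b).1) = proj ((sval a).2 |> (sval b).2).
Proof. by rewrite !projM (svalP a) (svalP b). Qed.

Definition fp_op (a b : fp_carrier) : fp_carrier :=
  exist _ ((sval a).1 |> (sval b).1, (sval a).2 |> (sval b).2)
    (fp_op_subproof a b).

Lemma fp_eq (a b : fp_carrier) :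
  (sval a).1 = (sval b).1 -> (sval a).2 = (sval b).2 -> a = b.
Proof.
case: a b => [[a a'] h] [[b b'] h'] /= ab ab'.
by apply: eq_exist; rewrite /= ab ab'.
Qed.

Lemma fp_nonempty : inhabited fp_carrier.
Proof. by case: w => y [z yz]; exists; exists (y, z). Qed.

Lemma fp_bij a : bijective (fp_op a).
Proof.
have [f fK Kf] := rack_bij (sval a).1; have [g gK Kg] := rack_bij (sval a).2.
have P (b : fp_carrier) : proj (f (sval b).1) = proj (g (sval b).2).
  apply: (bij_inj (rack_bij (proj (sval a).1))).
  by rewrite -projM Kf (svalP b) (svalP a) -projM Kg.
exists (fun b => exist _ (f (sval b).1, g (sval b).2) (P b)) => b.
  by apply: fp_eq => /=.
by apply: fp_eq => /=.
Qed.

Lemma fp_dist a b c : fp_op a (fp_op b c) = fp_op (fp_op a b) (fp_op a c).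
Proof. by apply: fp_eq; exact: rack_dist. Qed.

Definition fp_rack : rack := Rack_ fp_nonempty fp_bij fp_dist.

Lemma fp_kind : has_kind k fp_rack.
Proof.
move: (total_kind p) (total_kind q).
rewrite /has_kind; case: {+}k => //= [hp hq|[hp hp'] [hq hq']].
  by move=> a; apply: fp_eq => /=.
split=> [a|a b ab]; first by apply: fp_eq => /=.
by apply: fp_eq; [apply: hp'|apply: hq']; rewrite -[in RHS]ab.
Qed.

Lemma fp_projM : @rack_morphism fp_rack X (fun a => proj (sval a).1).
Proof. by move=> a b; exact: projM. Qed.

Definition fp : C := over fp_kind fp_projM.

Definition fp_pt y z (yz : @proj p y = @proj q z) : total fp :=
  exist _ (y, z) yz.

Definition fp1 : arrow fp p :=
  @mk_arrow fp p (fun a => (sval a).1) (fun _ _ => erefl) (fun=> erefl).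

Definition fp2 : arrow fp q :=
  @mk_arrow fp q (fun a => (sval a).2) (fun _ _ => erefl)
    (fun a => esym (svalP a)).

Lemma fp_pairing_subproof (r : C) (f : arrow r p) (g : arrow r q) y :
  proj (fct f y) = proj (fct g y).
Proof. by rewrite !proj_fct. Qed.

Definition fp_pairing (r : C) (f : arrow r p) (g : arrow r q) : arrow r fp.
Proof.
apply: (@mk_arrow r fp
  (fun y => fp_pt (fp_pairing_subproof f g y))).
  by move=> y z; apply: fp_eq; exact: fctM.
by move=> y; exact: (proj_fct f).
Defined.

Definition fp_product : product p q.
Proof.
apply: (@Product C p q fp fp1 fp2 fp_pairing) => r.
- by move=> f g; apply: arrow_ext.
- by move=> f g; apply: arrow_ext.
- by move=> h; apply: arrow_ext => y; apply: fp_eq.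
Defined.

End FibreProduct.

End Over.

(** * Fibrewise groups *)

(** The group structure on the fibres is encoded by total operations on Y, with
    axioms restricted to arguments in a common fibre; this avoids families of
    types indexed by X. *)
Record fibrewise_group (X Y : rack) (p : Y -> X) := FibrewiseGroup {
  fadd : Y -> Y -> Y;
  fopp : Y -> Y;
  fzero : X -> Y;
  fadd_over : forall a b, p a = p b -> p (fadd a b) = p a;
  fopp_over : forall a, p (fopp a) = p a;
  fzero_over : forall i, p (fzero i) = i;
  faddA : forall a b c, p a = p b -> p b = p c ->
    fadd (fadd a b) c = fadd a (fadd b c);
  faddC : forall a b, p a = p b -> fadd a b = fadd b a;
  fadd0 : forall a, fadd (fzero (p a)) a = a;
  faddN : forall a, fadd (fopp a) a = fzero (p a);
  fadd_op : forall a a' b b', p a = p a' -> p b = p b' ->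
    fadd a a' |> fadd b b' = fadd (a |> b) (a' |> b');
  fopp_op : forall a b, fopp (a |> b) = fopp a |> fopp b;
  fzero_op : forall i j, fzero (i |> j) = fzero i |> fzero j }.

Section GroupObjects.
Variables (k : rack_kind) (X : rack) (hX : has_kind k X) (p : racks_over hX).
Local Notation C := (racks_over hX).

Lemma fibrewise_group_object :
  fibrewise_group (@proj k X hX p) -> is_abelian_group_object p.
Proof.
move=> G.
have z0 : exists y z, @proj k X hX p y = @proj k X hX p z.
  by have [x] := rack_nonempty X; exists (fzero G x), (fzero G x).
pose sq := fp_product z0.
have z1 : exists y z, @proj k X hX sq y = @proj k X hX p z.
  have [x] := rack_nonempty X.
  by exists (fp_pt z0 (erefl : proj (fzero G x) = _)), (fzero G x).
pose cube := fp_product z1.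
have aM : @rack_morphism (total sq) (total p)
    (fun a => fadd G (sval a).1 (sval a).2).
  by move=> a b; rewrite (fadd_op G) //; [exact: (svalP a)|exact: (svalP b)].
have aO (a : total sq) : proj (fadd G (sval a).1 (sval a).2) = proj a.
  exact: fadd_over (svalP a).
pose add : arrow sq p := mk_arrow aM aO.
pose zero : arrow (over_terminal hX) p :=
  @mk_arrow k X hX (over_terminal hX) p (fzero G) (fzero_op G) (fzero_over G).
pose opp : arrow p p := @mk_arrow k X hX p p (fopp G) (fopp_op G) (fopp_over G).
exists; apply: (@AbelianGroupObject C p (over_terminal hX) sq cube add zero opp).
- apply: arrow_ext => a; apply: faddA; first exact: (svalP (sval a).1).
  by rewrite -(svalP a) /=; apply: esym; exact: (svalP (sval a).1).
- by apply: arrow_ext => a; apply: faddC; apply: esym; exact: (svalP a).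
- by apply: arrow_ext => a; exact: fadd0.
- by apply: arrow_ext => a; exact: faddN.
Qed.

(** The addition of two points of a fibre is the value, at the corresponding
    point of the explicit fibre product P, of the sum of its two projections.
    Naturality of [ptadd] makes addition of arrows pointwise, so each axiom is
    an identity of arrows evaluated at the right point of G, P or the threefold
    fibre product. *)
Lemma group_object_fibrewise :
  is_abelian_group_object p -> inhabited (fibrewise_group (@proj k X hX p)).
Proof.
case=> ag.
have [y0] := rack_nonempty (total p).
have w : exists y z, @proj k X hX p y = @proj k X hX p z by exists y0, y0.
pose P : C := fp w.
pose addP : arrow P p := ptadd ag (fp1 w) (fp2 w).
pose addY (a b : total p) : total p :=
  if pselect (proj a = proj b) is left ab then fct addP (fp_pt w ab)
  else a.
have fct_ptadd (c : C) (f g : arrow c p) z :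
    fct (ptadd ag f g) z = addY (fct f z) (fct g z).
  pose h : arrow c P := fp_pairing w f g.
  have -> : ptadd ag f g = addP \oC h.
    by rewrite /addP ptadd_comp; congr ptadd; apply: arrow_ext.
  rewrite /addY; case: pselect => [e|]; last by rewrite !proj_fct.
  by congr (fct addP _); apply: fp_eq.
have addYE a b (ab : proj a = proj b) :
    addY a b = fct addP (fp_pt w ab).
  by rewrite fct_ptadd.
pose one : C := over_terminal hX.
pose zero : X -> total p := fct (ptzero ag one).
have fct_ptzero (c : C) z : fct (ptzero ag c) z = zero (proj z).
  pose h : arrow c one := bang (over_terminal hX) c.
  by rewrite -(ptzero_comp ag h).
have w3 : exists y z, @proj k X hX P y = @proj k X hX p z.
  by exists (fp_pt w (erefl : proj y0 = _)), y0.
exists; apply: (@FibrewiseGroup _ _ _ addY (fct (ag_opp ag)) zero).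
- by move=> a b ab; rewrite addYE; exact: (proj_fct addP).
- exact: (proj_fct (ag_opp ag)).
- exact: (proj_fct (ptzero ag one)).
- move=> a b c ab bc.
  pose q : total (fp w3) := fp_pt w3 (etrans ab bc : proj (fp_pt w ab) = proj c).
  have := congr1 (fun u => fct u q)
    (ptaddA ag (fp1 w \oC fp1 w3) (fp2 w \oC fp1 w3) (fp2 w3)).
  by rewrite !fct_ptadd.
- move=> a b ab.
  have := congr1 (fun u => fct u (fp_pt w ab))
    (ptaddC ag (fp1 w) (fp2 w)).
  by rewrite !fct_ptadd.
- move=> a; have := congr1 (fun u => fct u a) (ptadd0 ag (idC p)).
  by rewrite fct_ptadd fct_ptzero.
- move=> a; have := congr1 (fun u => fct u a) (ptaddN ag (idC p)).
  by rewrite fct_ptadd fct_ptzero.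
- move=> a a' b b' aa' bb'.
  have ab : proj (a |> b) = proj (a' |> b') by rewrite !projM aa' bb'.
  rewrite !addYE -fctM; congr (fct addP _); exact: fp_eq.
- exact: (fctM (ag_opp ag)).
- exact: (fctM (ptzero ag one)).
Qed.

End GroupObjects.

(** * Modules and cocycles *)

(** Comparing the terms in u, t and s of the cocycle equation gives exactly the
    three module axioms. *)
Lemma module_rack_cocycle (X : rack) (A : zmodType) (M : xmodule X A) :
  rack_cocycle (module_cocycle M).
Proof.
split=> [i j s|i j l s t u]; rewrite /module_cocycle.
  have [g gK Kg] := eta_bij M i j.
  by exists (fun t => g (t - mod_tau M i j s)) => t; rewrite ?addrK ?Kg ?subrK.
rewrite !raddfD /= eta_eta eta_tau (tau_eta_tau M i j l s) -!addrA.
by congr (_ + _); rewrite addrCA.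
Qed.

Lemma module_dynamical_cocycle (k : rack_kind) (X : rack) (A : zmodType)
    (M : xmodule X A) :
  xmodule_has_kind k M -> dynamical_cocycle k (module_cocycle M).
Proof.
have qM : quandle_structure M -> quandle_cocycle (module_cocycle M).
  by move=> q; split=> [|i s]; [exact: module_rack_cocycle|exact: q].
case: k => //= [_|[/qM q c]]; first exact: module_rack_cocycle.
split=> // i j s t ij /(canRL (addKr _)) st.
have /(c i j ij s t) cji : t - mod_eta M i j t = mod_tau M i j s.
  by rewrite st addrC.
rewrite /module_cocycle -cji.
by rewrite addrC subrK.
Qed.

Section ExtensionGroup.
Variables (k : rack_kind) (X : rack) (hX : has_kind k X) (A : zmodType).
Variables (M : xmodule X A) (ha : dynamical_cocycle k (module_cocycle M)).
Local Notation Y := (total (ext_proj hX ha)).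

Lemma ext_fibrewise_group : fibrewise_group (@proj k X hX (ext_proj hX ha)).
Proof.
apply: (@FibrewiseGroup X Y _ (fun a b : X * A => (a.1, a.2 + b.2))
  (fun a : X * A => (a.1, - a.2)) (fun i => (i, 0))) => //.
- by move=> [i a] [j b] [l c] _ _; rewrite /= addrA.
- by move=> [i a] [j b]; rewrite /proj /= => ->; rewrite addrC.
- by move=> [i a]; rewrite /= add0r.
- by move=> [i a]; rewrite /= addNr.
- move=> [i a] [i' a'] [j b] [j' b']; rewrite /proj /= => <- <-.
  by rewrite /ext_op /module_cocycle /= !raddfD addrACA.
- by move=> [i a] [j b]; congr pair; rewrite /= /module_cocycle !raddfN opprD.
- by move=> i j; congr pair; rewrite /= /module_cocycle !raddf0 addr0.
Qed.

End ExtensionGroup.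

(** * The module of a trivialized fibrewise group *)

Section FibrewiseGroupTheory.
Variables (X Y : rack) (p : Y -> X) (G : fibrewise_group p).
Local Notation zero := (fzero G).

Lemma fadd_zero i : fadd G (zero i) (zero i) = zero i.
Proof. by rewrite -[in X in fadd G X _](fzero_over G i) fadd0. Qed.

End FibrewiseGroupTheory.

(* Here [gamma i] is an isomorphism from A to the fibre over i, and [delta] is
   its inverse on each of the fibres at once. *)
Section Trivialization.
Variables (X Y : rack) (p : Y -> X) (pM : rack_morphism p).
Variables (G : fibrewise_group p) (A : zmodType).
Variables (gamma : X -> A -> Y) (delta : Y -> A).
Hypothesis gamma_over : forall i a, p (gamma i a) = i.
Hypothesis gammaK : forall i, cancel (gamma i) delta.
Hypothesis deltaK : forall y, gamma (p y) (delta y) = y.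
Hypothesis gammaD : forall i a b,
  gamma i (a + b) = fadd G (gamma i a) (gamma i b).
Local Notation zero := (fzero G).

Lemma gamma_inj i : injective (gamma i).
Proof. exact: can_inj (gammaK i). Qed.

Definition eta_fun i j (a : A) : A := delta (zero i |> gamma j a).
Definition tau_fun i j (a : A) : A := delta (gamma i a |> zero j).

Lemma gamma_eta i j a : gamma (i |> j) (eta_fun i j a) = zero i |> gamma j a.
Proof. by rewrite -[RHS]deltaK pM gamma_over fzero_over. Qed.

Lemma gamma_tau i j a : gamma (i |> j) (tau_fun i j a) = gamma i a |> zero j.
Proof. by rewrite -[RHS]deltaK pM gamma_over fzero_over. Qed.

(** The compatibility of addition with |> is applied to the decompositions
    0_i + a and b + 0_j of the two arguments. *)
Lemma gamma_op i j s t :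
  gamma i s |> gamma j t = gamma (i |> j) (eta_fun i j t + tau_fun i j s).
Proof.
rewrite gammaD gamma_eta gamma_tau -fadd_op ?fzero_over ?gamma_over //.
have zE l a : fadd G (zero l) (gamma l a) = gamma l a.
  by rewrite -[in zero l](gamma_over l a) fadd0.
by rewrite zE faddC ?zE ?fzero_over ?gamma_over.
Qed.

Lemma eta_fun_additive i j : zmod_morphism (eta_fun i j).
Proof.
have etaD a b : eta_fun i j (a + b) = eta_fun i j a + eta_fun i j b.
  apply: (@gamma_inj (i |> j)); rewrite gammaD !gamma_eta.
  by rewrite -fadd_op ?gamma_over // -gammaD fadd_zero.
by move=> a b; apply: (addIr (eta_fun i j b)); rewrite -etaD !subrK.
Qed.

Lemma tau_fun_additive i j : zmod_morphism (tau_fun i j).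
Proof.
have tauD a b : tau_fun i j (a + b) = tau_fun i j a + tau_fun i j b.
  apply: (@gamma_inj (i |> j)); rewrite gammaD !gamma_tau.
  by rewrite -fadd_op ?gamma_over // -gammaD fadd_zero.
by move=> a b; apply: (addIr (tau_fun i j b)); rewrite -tauD !subrK.
Qed.

HB.instance Definition _ i j :=
  GRing.isZmodMorphism.Build A A (eta_fun i j) (eta_fun_additive i j).
HB.instance Definition _ i j :=
  GRing.isZmodMorphism.Build A A (tau_fun i j) (tau_fun_additive i j).

Lemma eta_fun_bij i j : bijective (eta_fun i j).
Proof.
have [g gK Kg] := rack_bij (zero i).
exists (fun b => delta (g (gamma (i |> j) b))) => b.
  by rewrite gamma_eta gK gammaK.
have pg : p (g (gamma (i |> j) b)) = j.
  by apply: (bij_inj (rack_bij i)); rewrite -{1}(fzero_over G i) -pM Kg ?gamma_over.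
by rewrite /eta_fun -[X in gamma X _]pg deltaK Kg gammaK.
Qed.

(** After applying [gamma], each axiom is self-distributivity for a triple with
    two zero entries, the remaining entry being the third one for eta-eta, the
    first for tau and the second for eta-tau. *)
Definition trivialized_module : xmodule X A.
Proof.
apply: (@XModule X A (fun i j => eta_fun i j) (fun i j => tau_fun i j)).
- exact: eta_fun_bij.
- move=> i j l a; apply: (@gamma_inj (i |> (j |> l))) => /=.
  by rewrite !gamma_eta [in RHS]rack_dist !gamma_eta fzero_op -rack_dist.
- move=> i j l a; apply: (@gamma_inj (i |> (j |> l))) => /=.
  rewrite gamma_tau [in RHS]rack_dist -gamma_op !gamma_tau -rack_dist.
  by rewrite fzero_op.
- move=> i j l a; apply: (@gamma_inj (i |> (j |> l))) => /=.
  rewrite gamma_eta gamma_tau [in RHS]rack_dist gamma_tau gamma_eta.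
  by rewrite fzero_op -rack_dist.
Defined.

Lemma trivialized_cocycleE i j s t :
  gamma i s |> gamma j t =
  gamma (i |> j) (module_cocycle trivialized_module i j s t).
Proof. exact: gamma_op. Qed.

(** Translated by [gamma], the condition t - eta_ij t = tau_ij s says that the
    left translation by s over i fixes t over j, as soon as i |> j = j.  The
    symmetric condition on X needed to conclude comes from the crossed set
    axiom applied to the zero section. *)
Lemma trivialized_kind (k : rack_kind) :
  has_kind k Y -> xmodule_has_kind k trivialized_module.
Proof.
have qM : is_quandle Y -> quandle_structure trivialized_module.
  move=> q i a; apply: (@gamma_inj i).
  rewrite -[RHS]q trivialized_cocycleE; congr gamma.
  by rewrite -[in RHS](gamma_over i a) -pM q.
case: k => //= -[/[dup] q /qM q' c]; split=> // i j ij s t st.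
have ji : j |> i = i.
  rewrite -(fzero_over G i) -(fzero_over G j) -pM c //.
  by rewrite -fzero_op ij.
have /c : gamma i s |> gamma j t = gamma j t.
  by rewrite trivialized_cocycleE ij /module_cocycle -st addrC subrK.
rewrite trivialized_cocycleE ji => /gamma_inj e.
by rewrite -{1}e /module_cocycle addrAC subrr add0r.
Qed.

End Trivialization.

(** * Indecomposable racks *)

(** A union W of orbits satisfies W |> W = W, with no finiteness assumption:
    an element x of W is x |> y where y, the preimage of x under its own left
    translation, lies in W as well. *)
Lemma indecomposable_invariant (X : rack) (Z : set X) :
    indecomposable X -> Z !=set0 -> (forall i j, Z (i |> j) <-> Z j) ->
  Z = [set: X].
Proof.
move=> indX Z0 invZ.
have sub (W : set X) : W !=set0 -> (forall i j, W (i |> j) <-> W j) ->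
    subrack W.
  move=> W0 invW; split=> //; apply/seteqP; split=> [x [i _ [j Wj <-]]|x Wx].
    exact/invW.
  have [g _ Kg] := rack_bij x.
  by exists x => //; exists (g x); [apply/(invW x); rewrite Kg|exact: Kg].
apply: contrapT => ZT; apply: indX; exists Z, (~` Z); split.
- exact: sub.
- apply: sub; last by move=> i j; split=> nZ /(invZ i j) /nZ.
  apply/set0P/eqP => Z'0; apply: ZT.
  by rewrite -[Z]setCK Z'0 setC0.
- exact: setICr.
- exact: setUv.
Qed.

(** * The fibres over an indecomposable rack *)

Section FibreIso.
Variables (X Y : rack) (p : Y -> X) (pM : rack_morphism p).
Variable G : fibrewise_group p.

(** Total functions on Y, to match the total operations of a fibrewise group,
    stand for an isomorphism from the fibre over i to the fibre over j and its
    inverse. *)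
Definition fibre_iso i j (f g : Y -> Y) : Prop :=
  [/\ forall a, p a = i -> p (f a) = j /\ g (f a) = a,
      forall b, p b = j -> p (g b) = i /\ f (g b) = b &
      forall a b, p a = i -> p b = i ->
        f (fadd G a b) = fadd G (f a) (f b)].

Lemma fibre_iso_id i : fibre_iso i i id id.
Proof. by []. Qed.

Lemma fibre_iso_comp i j l f g f' g' : fibre_iso i j f g ->
  fibre_iso j l f' g' -> fibre_iso i l (f' \o f) (g \o g').
Proof.
move=> [fK gK fD] [fK' gK' fD']; split=> [a ai|b bl|a b ai bi] /=.
- by have [fa gfa] := fK _ ai; have [? ->] := fK' _ fa.
- by have [gb fgb] := gK' _ bl; have [? ->] := gK _ gb.
- by rewrite fD // fD' //; apply: (fK _ _).1.
Qed.

Lemma fibre_iso_sym i j f g : fibre_iso i j f g -> fibre_iso j i g f.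
Proof.
move=> [fK gK fD]; split=> // a b aj bj.
have [[ga fga] [gb fgb]] := (gK _ aj, gK _ bj).
by rewrite -{1}fga -{1}fgb -fD //; apply: (fK _ _).2; rewrite fadd_over ?ga.
Qed.

(** Left translation by the zero section is additive on fibres because
    0_i = 0_i + 0_i. *)
Lemma fibre_iso_translation i j : exists f g, fibre_iso j (i |> j) f g.
Proof.
have [g gK Kg] := rack_bij (fzero G i); exists (rack_op (fzero G i)), g.
split=> [a aj|b bj|a b aj bj].
- by rewrite pM fzero_over aj gK.
- split; last exact: Kg.
  by apply: (bij_inj (rack_bij i)); rewrite -{1}(fzero_over G i) -pM Kg ?gamma_over.
- by rewrite -fadd_op ?aj ?bj // fadd_zero.
Qed.

Lemma fibre_iso_exists x0 i :
  indecomposable X -> exists f g, fibre_iso x0 i f g.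
Proof.
move=> indX.
have : [set i | exists f g, fibre_iso x0 i f g] = [set: X].
  apply: indecomposable_invariant => // [|l j].
    by exists x0, id, id; exact: fibre_iso_id.
  have [t [t' ht]] := fibre_iso_translation l j.
  split=> -[f [g h]]; last first.
    by exists (t \o f), (g \o t'); exact: fibre_iso_comp h ht.
  exists (t' \o f), (g \o t).
  exact: fibre_iso_comp h (fibre_iso_sym ht).
by move/seteqP => -[_ /(_ i I)].
Qed.

End FibreIso.

(** * The fibre as an abelian group *)

Section Fibre.
Variables (X Y : rack) (p : Y -> X) (G : fibrewise_group p) (x : X).

(** The group law depends on the whole structure G and not only on the carrier,
    so G is a (phantom) parameter of the type, for instances to be found. *)
Definition fibre of fibrewise_group p : Type := {y : Y | p y = x}.
Local Notation F := (fibre G).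

Lemma fibre_val_inj (a b : F) : sval a = sval b -> a = b.
Proof. by case: a b => [a ax] [b bx] /= ab; exact: eq_exist. Qed.

Lemma fibre_add_over (a b : F) : p (fadd G (sval a) (sval b)) = x.
Proof. by rewrite fadd_over (svalP a) ?(svalP b). Qed.

Definition fibre_add (a b : F) : F := exist _ _ (fibre_add_over a b).
Definition fibre_opp (a : F) : F :=
  exist _ _ (etrans (fopp_over G (sval a)) (svalP a)).
Definition fibre_zero : F := exist _ _ (fzero_over G x).

HB.instance Definition _ := gen_eqMixin F.
HB.instance Definition _ := gen_choiceMixin F.

Lemma fibre_addA : associative fibre_add.
Proof.
move=> a b c; apply: fibre_val_inj; apply: esym.
by apply: faddA; rewrite (svalP b) ?(svalP a) ?(svalP c).
Qed.

Lemma fibre_addC : commutative fibre_add.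
Proof.
by move=> a b; apply: fibre_val_inj; apply: faddC; rewrite (svalP a) (svalP b).
Qed.

Lemma fibre_add0 : left_id fibre_zero fibre_add.
Proof.
move=> a; apply: fibre_val_inj; rewrite -[RHS](fadd0 G) /=.
by rewrite (svalP a).
Qed.

Lemma fibre_addN : left_inverse fibre_zero fibre_opp fibre_add.
Proof.
by move=> a; apply: fibre_val_inj; rewrite /= faddN (svalP a).
Qed.

HB.instance Definition _ :=
  GRing.isZmodule.Build F fibre_addA fibre_addC fibre_add0 fibre_addN.

End Fibre.

(** * Group objects over an indecomposable rack *)

Lemma trivialization_exists (X Y : rack) (p : Y -> X)
    (pM : rack_morphism p) (G : fibrewise_group p) : indecomposable X ->
  exists (A : zmodType) (gamma : X -> A -> Y) (delta : Y -> A),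
    [/\ forall i a, p (gamma i a) = i,
        forall i, cancel (gamma i) delta,
        forall y, gamma (p y) (delta y) = y &
        forall i a b, gamma i (a + b) = fadd G (gamma i a) (gamma i b)].
Proof.
move=> indX; have [x] := rack_nonempty X.
have /choice [f /choice [g fg]] : forall i, exists f g, fibre_iso G x i f g.
  by move=> i; exact: fibre_iso_exists.
have gP y : p (g (p y) y) = x.
  by have [_ gK _] := fg (p y); apply: (gK _ _).1.
exists (fibre x G), (fun i a => f i (sval a)),
  (fun y => exist (fun y => p y = x) _ (gP y)).
split=> [i a|i a|y|i a b].
- by have [fK _ _] := fg i; apply: (fK _ (svalP a)).1.
- have [fK _ _] := fg i; have [fa gfa] := fK _ (svalP a).
  by apply: fibre_val_inj; rewrite /= fa gfa.
- by have [_ gK _] := fg (p y); apply: (gK _ _).2.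
- by have [_ _ fD] := fg i; apply: fD; [exact: (svalP a)|exact: (svalP b)].
Qed.

Lemma group_object_ext (k : rack_kind) (X : rack) (hX : has_kind k X)
    (p : racks_over hX) :
    is_abelian_group_object p -> indecomposable X ->
  exists (A : zmodType) (M : xmodule X A)
         (ha : dynamical_cocycle k (module_cocycle M)),
    xmodule_has_kind k M /\ isomorphic p (ext_proj hX ha).
Proof.
move=> /group_object_fibrewise [G] indX.
have pM := @projM k X hX p.
have [A [gamma [delta [gO gK dK gD]]]] := trivialization_exists pM G indX.
pose M := trivialized_module pM gO gK dK gD.
have kM : xmodule_has_kind k M.
  exact: trivialized_kind (total_kind p).
exists A, M, (module_dynamical_cocycle kM); split=> //.
apply: (@bijective_isomorphic k X hX p (ext_proj hX _)
  (fun y => (proj y, delta y)) (fun z => gamma z.1 z.2)) => //.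
- move=> y z; congr pair; first exact: pM.
  rewrite -[in LHS](dK y) -[in LHS](dK z) (trivialized_cocycleE pM gO gK dK gD).
  by rewrite gK.
- by move=> [i a]; rewrite /= gO gK.
Qed.

Theorem theorem2p18 (k : rack_kind) (X : rack) (hX : has_kind k X) :
  (* (1) *)
  (forall (A : zmodType) (M : xmodule X A),
     xmodule_has_kind k M -> dynamical_cocycle k (module_cocycle M)) /\
  (* (2) *)
  (forall (A : zmodType) (M : xmodule X A),
     xmodule_has_kind k M ->
     forall ha : dynamical_cocycle k (module_cocycle M),
       is_abelian_group_object (ext_proj hX ha)) /\
  (* (3) *)
  (forall p : racks_over hX,
     is_abelian_group_object p -> indecomposable X ->
     exists (A : zmodType) (M : xmodule X A)
            (ha : dynamical_cocycle k (module_cocycle M)),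
       xmodule_has_kind k M /\ isomorphic p (ext_proj hX ha)).
Proof.
split; first by move=> A M; exact: module_dynamical_cocycle.
split=> [A M _ ha|p]; last exact: group_object_ext.
exact/fibrewise_group_object/ext_fibrewise_group.
Qed.
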